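(* Let $C$ be an extended linear code of length $d+1$ over $\mathbb{Z}_N$ and let $g=(g_{ji})$ be a generating matrix of $C$, with $m$ rows and with columns indexed by $i=0,\dots,d$. Put $\gcd_i=\gcd(g_{1i},\dots,g_{mi},N)$. If the linear code $C$ is thin, then $$\sum_{i=0}^d \gcd\nolimits_i>N.$$
   Context: $\mathbb{Z}_N=\mathbb{Z}/N\mathbb{Z}$; its elements are identified with the representatives $0,1,\dots,N-1$, and gcd's are taken of these integers. A linear code of length $n$ over $\mathbb{Z}_N$ is a submodule $C\subseteq\mathbb{Z}_N^n$; its elements are called words; a generating matrix is a matrix whose rows generate $C$. $C$ is extended if every word has coordinate sum $0\bmod N$. An extended code is thin if it contains no word of maximal weight, i.e. no word all of whose entries are nonzero.
   Formalization: The condition d ≥ 1 (length at least 2) is added: for d = 0 the only extended code is {0}, which is thin, but gcd_0 = N, so the sum equals N and the strict inequality fails. *)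

(* Defs.v *)
From HB Require Import structures.
From mathcomp Require Import all_boot all_order all_algebra.

Set Implicit Arguments.
Unset Strict Implicit.
Unset Printing Implicit Defensive.

Import GRing.Theory.
Local Open Scope ring_scope.

(* The ring Z/NZ for N >= 1, on the representatives 0, ..., N-1. The library's
   'Z_N is Z/2Z when N = 1, and its ring structure on ordinals only covers
   'I_n.+2; Zmod 1 is the zero ring. Zmod 0 also denotes the zero ring, so
   statements assume 0 < N. *)
Definition Zmod (N : nat) : Type := 'I_N.-1.+1.

HB.instance Definition _ (N : nat) := Finite.on (Zmod N).
HB.instance Definition _ (N : nat) := GRing.Zmodule.on (Zmod N).
HB.instance Definition _ (N : nat) :=
  GRing.Zmodule_isComPzRing.Build (Zmod N)
    (@Zp_mulA _) (@Zp_mulC _) (@Zp_mul1z _) (@Zp_mul_addl _).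

Definition Zmod_rep (N : nat) (x : Zmod N) : nat := nat_of_ord x.

Definition linear_code (N n : nat) (C : {set 'rV[Zmod N]_n}) : Prop :=
  submod_closed C.

Definition generating_matrix (N m n : nat) (g : 'M[Zmod N]_(m, n))
    (C : {set 'rV[Zmod N]_n}) : Prop :=
  forall w : 'rV[Zmod N]_n,
    w \in C <-> exists a : 'I_m -> Zmod N, w = \sum_(j < m) a j *: row j g.

Definition extended_code (N n : nat) (C : {set 'rV[Zmod N]_n}) : Prop :=
  forall w : 'rV[Zmod N]_n, w \in C -> \sum_(i < n) w 0 i = 0.

Definition thin_code (N n : nat) (C : {set 'rV[Zmod N]_n}) : Prop :=
  extended_code C /\
  ~ exists2 w : 'rV[Zmod N]_n, w \in C & forall i : 'I_n, w 0 i != 0.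

Definition col_gcd (N m n : nat) (g : 'M[Zmod N]_(m, n)) (i : 'I_n) : nat :=
  gcdn (\big[gcdn/0%N]_(j < m) Zmod_rep (g j i)) N.

(* Main.v *)
From HB Require Import structures.
Require Import Defs.
From mathcomp Require Import all_boot all_order all_algebra.

(** Count pairs (word, zero coordinate).  Each word of a thin code has a zero
    coordinate and the zero word has [d + 1 >= 2] of them, so there are more than
    [#|C|] pairs.  On the other hand, if [t] is the size of the projection of [C]
    to the coordinate [i], then exactly [#|C| / t] words vanish at [i]; since [t]
    annihilates that projection, [N] divides [t * gcd_i], whence
    [N * (#|C| / t) <= #|C| * gcd_i].  Summing over [i] gives the inequality. *)

Import GRing.Theory.
Local Open Scope ring_scope.

Lemma mulrn_card_zmod_closed (W : finZmodType) (I : {set W}) (y : W) :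
  zmod_closed I -> y \in I -> y *+ #|I| = 0.
Proof.
move=> [I0 IB] Iy.
have IN x : x \in I -> - x \in I by move=> Ix; rewrite -[- x]add0r IB.
have IE z : (z + y \in I) = (z \in I).
  apply/idP/idP => Iz; first by rewrite -[z](addrK y) IB.
  by rewrite -[y]opprK IB // IN.
(* Translation by [y] permutes [I], so it does not change the sum of [I]. *)
have : \sum_(z in I) z = \sum_(z in I) (z + y).
  by rewrite (reindex_inj (addIr y)); apply: eq_bigl => z; rewrite IE.
rewrite big_split /= sumr_const => /eqP.
by rewrite -[X in X == _]addr0 (inj_eq (addrI _)) eq_sym => /eqP.
Qed.

Lemma zmod_closed_imset (V W : finZmodType) (f : {additive V -> W})
    (C : {set V}) :
  zmod_closed C -> zmod_closed (f @: C).
Proof.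
move=> [C0 CB]; split; first by rewrite -(raddf0 f) imset_f.
move=> _ _ /imsetP[x Cx ->] /imsetP[y Cy ->].
by rewrite -raddfB imset_f // CB.
Qed.

(** The fibre of [f] in [C] over [f a] is the translate by [a] of the kernel on [C], so all nonempty
    fibres have the same size. *)
Lemma card_imset_kernel (V W : finZmodType) (f : {additive V -> W})
    (C : {set V}) :
  zmod_closed C -> #|C| = (#|f @: C| * #|[set x in C | f x == 0%R]|)%N.
Proof.
move=> [C0 CB].
have CN x : x \in C -> - x \in C by move=> Cx; rewrite -[- x]add0r CB.
rewrite -sum1_card (partition_big_imset f) /= -sum_nat_const.
apply: eq_bigr => _ /imsetP[a Ca ->]; rewrite sum1dep_card.
rewrite -[RHS](card_imset _ (addIr a)); apply: eq_card => x; rewrite inE.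
apply/andP/imsetP => [[Cx /eqP fx]|[y]].
  by exists (x - a); rewrite ?subrK // inE CB // raddfB fx subrr eqxx.
rewrite inE => /andP[Cy /eqP fy] ->; rewrite raddfD fy add0r; split=> //.
by rewrite -[a]opprK CB // CN.
Qed.

Lemma Zmod_natmul_eq0 (N : nat) (x : Zmod N) (k : nat) :
  (0 < N)%N -> x *+ k = 0 -> (N %| k * Zmod_rep x)%N.
Proof.
move=> N_gt0 /(congr1 val).
rewrite [x *+ k](Zp_mulrn (x : 'I_N.-1.+1) k) /= -/(Zmod_rep x) mulnC.
(* The ordinal arithmetic reduces modulo [N.-1.+1], which is [N] because [0 < N]. *)
by move/eqP; rewrite -/(dvdn _ _) prednK.
Qed.

(** Multiplication by [k] distributes over gcd, the empty gcd [0] included, so only the multiples of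
    the single entries and of [N] matter. *)
Lemma dvdn_mul_col_gcd (N m n k : nat) (g : 'M[Zmod N]_(m, n)) (i : 'I_n) :
  (forall j, N %| k * Zmod_rep (g j i))%N -> (N %| k * col_gcd g i)%N.
Proof.
move=> Nkg; rewrite /col_gcd muln_gcdr dvdn_gcd (dvdn_mull k (dvdnn N)) andbT.
rewrite (big_morph (muln k) (muln_gcdr k) (muln0 k)).
by apply: (big_ind (fun x => N %| x)%N) => // x y Nx Ny; rewrite dvdn_gcd Nx.
Qed.

Lemma generating_matrix_row (N m n : nat) (g : 'M[Zmod N]_(m, n))
    (C : {set 'rV[Zmod N]_n}) (j : 'I_m) :
  generating_matrix g C -> row j g \in C.
Proof.
move=> gC; apply/gC; exists (fun k => (k == j)%:R).
rewrite (bigD1 j) //= eqxx scale1r big1 ?addr0 // => k /negPf->.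
by rewrite scale0r.
Qed.

Lemma linear_code_zmod_closed (N n : nat) (C : {set 'rV[Zmod N]_n}) :
  linear_code C -> zmod_closed C.
Proof.
move=> [C0 CD]; split=> // x y Cx Cy.
by rewrite addrC -scaleN1r CD.
Qed.

Lemma card_zero_coord_le (N m n : nat) (g : 'M[Zmod N]_(m, n))
    (C : {set 'rV[Zmod N]_n}) (i : 'I_n) :
  (0 < N)%N -> linear_code C -> generating_matrix g C ->
  (N * #|[set w in C | w ord0 i == 0%R]| <= #|C| * col_gcd g i)%N.
Proof.
move=> N_gt0 /linear_code_zmod_closed Cz gC.
pose p (w : 'rV[Zmod N]_n) : Zmod N := w ord0 i.
have p_additive : zmod_morphism p by move=> u v; rewrite /p !mxE.
pose pM := GRing.isZmodMorphism.Build _ _ p p_additive.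
pose f : {additive 'rV[Zmod N]_n -> Zmod N} := HB.pack p pM.
have cardC := @card_imset_kernel _ _ f C Cz.
(* Cancelling the number of words that vanish at [i] leaves [N <= #|f @: C| * col_gcd g i]. This
   follows from divisibility, as the right side is positive. *)
rewrite [X in (_ <= X * _)%N]cardC mulnAC leq_mul2r.
apply/orP; right; apply: dvdn_leq.
  rewrite muln_gt0 gcdn_gt0 N_gt0 orbT andbT.
  by apply/card_gt0P; exists (f 0); apply: imset_f; case: Cz.
apply: dvdn_mul_col_gcd => j; apply: Zmod_natmul_eq0 => //.
apply: mulrn_card_zmod_closed; first exact: zmod_closed_imset.
have -> : g j i = f (row j g) by rewrite /= /p mxE.
exact/imset_f/generating_matrix_row.
Qed.

Lemma sum_card_zero_coord (N n : nat) (C : {set 'rV[Zmod N]_n}) :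
  (\sum_(i < n) #|[set w in C | w ord0 i == 0%R]|
   = \sum_(w in C) #|[set i | w ord0 i == 0%R]|)%N.
Proof.
transitivity (\sum_(i < n) \sum_(w in C) (w ord0 i == 0%R : nat))%N.
  by apply: eq_bigr => i _; rewrite -sum1dep_card big_mkcondr.
rewrite exchange_big; apply: eq_bigr => w _.
by rewrite -sum1dep_card [RHS]big_mkcond.
Qed.

Lemma thin_code_card_lt (N d : nat) (C : {set 'rV[Zmod N]_d.+1}) :
  (0 < d)%N -> linear_code C -> thin_code C ->
  (#|C| < \sum_(i < d.+1) #|[set w in C | w ord0 i == 0%R]|)%N.
Proof.
move=> d_gt0 [C0 _] [_ thinC]; rewrite sum_card_zero_coord -sum1_card.
(* The zero word is split off on both sides: it contributes [d.+1], at least 2 by [0 < d], against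
   1, which makes the inequality strict. *)
rewrite (bigD1 0) //= [X in (_ < X)%N](bigD1 0) //= -addSn leq_add //.
  rewrite (_ : [set i | _] = setT) ?cardsT ?card_ord //.
  by apply/setP => i; rewrite !inE mxE eqxx.
apply: leq_sum => w /andP[Cw _]; rewrite card_gt0; apply/set0Pn.
have [/existsP[i wi]|] := boolP [exists i, w ord0 i == 0].
  by exists i; rewrite inE.
by move=> /existsPn w_neq0; case: thinC; exists w.
Qed.

Local Close Scope ring_scope.

Theorem proposition2p12 (N d m : nat) (hN : 0 < N) (hd : 0 < d)
    (C : {set 'rV[Zmod N]_d.+1}) (g : 'M[Zmod N]_(m, d.+1))
    (hC : linear_code C) (hext : extended_code C)
    (hg : generating_matrix g C) (hthin : thin_code C) :
  N < \sum_(i < d.+1) col_gcd g i.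
Proof.
have C_gt0 : 0 < #|C| by apply/card_gt0P; exists 0%R; case: hC.
(* Scaling the goal by [#|C|] and the count of zeros by [N] lets the two sums be compared coordinate
   by coordinate. *)
rewrite -(ltn_pmul2l C_gt0) big_distrr /=.
have lt_NC := thin_code_card_lt N d C hd hC hthin.
rewrite -(ltn_pmul2l hN) mulnC big_distrr /= in lt_NC.
apply: leq_trans lt_NC _; apply: leq_sum => i _.
exact: card_zero_coord_le.
Qed.
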